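(* Let $t\geq 1$ and let $S$ be a $t$-sumfree sequence with characteristic sequence $C$. Suppose that, for some integers $K\geq 0$, $M\geq 1$ and $Q\geq 1$, the sequence $C$ contains $Q$ consecutive, identical, non-null blocks of length $M$ from position $K+1$ on (that is, the $Q$ blocks $(C_{K+jM+1},\ldots,C_{K+(j+1)M})$, $0\leq j\leq Q-1$, are all equal and not identically zero), such that $$\Big(Q-\frac{t(t+1)}{2}\Big)M\geq (t-1)K.$$ Then $C$ is ultimately periodic, with a period $E$ of length $m$, a divisor of $M$. Hence $S$, when taken modulo $m$, is also ultimately periodic, with period length $p$ equal to the number of 1's in $E$, and with preperiod length $k$, where $k$ is at most the number of 1's among the first $K$ entries of $C$.
   Context: For $t\geq 1$ and positive integers $s_1<s_2<\cdots<s_t$, the (greedy, strict) $t$-sumfree sequence with these initial values is $S=(s_1,s_2,s_3,\ldots)$ where, for $n>t$, $s_n$ is the smallest integer exceeding $s_{n-1}$ that is not equal to the sum of $t$ different elements among $s_1,\ldots,s_{n-1}$. Its characteristic sequence is $C=(C_1,C_2,\ldots)$ with $C_z=1$ if $z$ is an entry of $S$ and $C_z=0$ otherwise. Saying that $S$, taken modulo $m$, is ultimately periodic with period length $p$ and preperiod length $k$ means that $s_{n+p}=s_n+m$ for all $n>k$ (so after the first $k$ entries, $S$ consists of the residue classes modulo $m$ of $p$ consecutive entries, from those entries on). *)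

(* Defs.v *)
From mathcomp Require Import all_boot all_order all_algebra.

Set Implicit Arguments.
Unset Strict Implicit.
Unset Printing Implicit Defensive.

(* All sequences are indexed from 1: the value at index 0 is never used. *)

Definition sum_of_distinct (t : nat) (B : seq nat) (x : nat) : Prop :=
  exists A : seq nat,
    [/\ uniq A, size A = t, {subset A <= B} & sumn A = x].

Definition entries (s : nat -> nat) (n : nat) : seq nat :=
  [seq s i | i <- iota 1 n].

Definition least_such_that (P : nat -> Prop) (x : nat) : Prop :=
  P x /\ forall y, P y -> x <= y.

Definition tsumfree (t : nat) (s : nat -> nat) : Prop :=
  [/\ 0 < s 1,
      forall n, 0 < n < t -> s n < s n.+1
    & forall n, t <= n ->
        least_such_that
          (fun x => s n < x /\ ~ sum_of_distinct t (entries s n) x)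
          (s n.+1)].

Definition characteristic_sequence (s : nat -> nat) (C : nat -> bool) : Prop :=
  forall z, 0 < z -> C z <-> exists2 n, 0 < n & s n = z.

(* (C_{K+jM+1}, ..., C_{K+(j+1)M}) *)
Definition block (C : nat -> bool) (K M j : nat) : seq bool :=
  [seq C (K + j * M + i) | i <- iota 1 M].

Definition identical_nonnull_blocks (C : nat -> bool) (K M Q : nat) : Prop :=
  (forall j j', j < Q -> j' < Q -> block C K M j = block C K M j') /\
  (forall j, j < Q -> true \in block C K M j).

(* From some position on, C is the infinite repetition of the word E. *)
Definition ultimately_periodic (C : nat -> bool) (E : seq bool) : Prop :=
  0 < size E /\
  exists N, forall i, C (N + i.+1) = nth false E (i %% size E).

(* s taken modulo m is ultimately periodic with period length p and
   preperiod length k; neither p nor k is required to be minimal. *)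
Definition ultimately_periodic_mod (s : nat -> nat) (m p k : nat) : Prop :=
  forall n, k < n -> s (n + p) = s n + m.

(* Main.v *)
Require Import Defs.
From mathcomp Require Import all_boot all_order all_algebra.
From mathcomp Require Import zify.

Set Implicit Arguments.
Unset Strict Implicit.
Unset Printing Implicit Defensive.

(** Why the theorem holds.  Past the initial values, [z] is an entry exactly
    when it is not a sum of [t] distinct smaller entries
    ([tsumfree_membership]).  For [t >= 2] one shows [C (z + M) = C z] for
    every [z > K] by strong induction on [z]; the blocks settle all
    [z <= K + (Q - 1) M], and for larger [z] a representation of one of [z],
    [z + M] as a sum of [t] distinct smaller entries yields one of the other,
    by moving a single summand by [M], where the induction hypothesis says
    that entries stay entries.

    - Upwards ([sum_shift_up]): the largest summand exceeds [K], because [z]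
      exceeds [t K], and [M] is added to it; being the largest it cannot
      collide with another summand.
    - Downwards ([sum_shift_down]): a summand [a > K + M] is needed such that
      [a - M] is not already a summand.  If there is none, every residue class
      of summands modulo [M] climbs in steps of [M] from a start at most
      [K + M], so the [i]-th smallest summand is at most [K + i M] and the sum
      is at most [t K + (t (t + 1) / 2) M] ([sumn_downward_closed]).  The
      inequality assumed on [Q] says precisely that this is at most
      [K + Q M], hence less than [z + M].

    Passing between entries and representations requires that the greedy rule
    already governs [z], that is [s t < z].  The [Q] non-null blocks provide [Q - 1 >= t] entries below
    [z], which is enough ([entry_le_block_end]).

    Periodicity of [s] follows by counting: [s n] is the unique entry having
    [n] entries up to and including it, and every window of length [M] beyond
    [K] contains the same number of entries.

    For [t = 1] the bound [Q - 1 >= t] can fail, and a block may straddle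
    [s 1]; but then [S] consists of all integers from [s 1] on, and the period
    is [1]. *)

(** * Replacing one summand *)

Lemma seq_max_exists (A : seq nat) :
  0 < size A -> exists2 m, m \in A & forall a, a \in A -> a <= m.
Proof.
elim: A => // x A IH _; case: (posnP (size A)) => [/size0nil -> | /IH [m mA mP]].
  by exists x; rewrite ?mem_head // => a; rewrite inE => /eqP ->.
exists (maxn x m) => [|a].
  by rewrite inE /maxn; case: ifP => _; rewrite ?eqxx // mA orbT.
by rewrite inE leq_max => /orP[/eqP -> | /mP ->]; rewrite ?leqnn // orbT.
Qed.

Lemma sum_of_distinct_replace (t : nat) (B A : seq nat) (a b : nat) :
    uniq A -> size A = t -> a \in A -> b \notin A ->
    {subset A <= B} -> b \in B ->
  sum_of_distinct t B (sumn A + b - a).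
Proof.
move=> uA sA aA bA AB bB; have pA := perm_to_rem aA.
exists (b :: rem a A); split.
- by rewrite /= rem_uniq // andbT; apply: contra bA; apply: mem_rem.
- by rewrite -sA (perm_size pA).
- by move=> x; rewrite inE => /orP[/eqP -> // | /mem_rem /AB].
- by rewrite (perm_sumn pA) /=; lia.
Qed.

Lemma half_pronicS (n : nat) :
  n.+1 * n.+2 %/ 2 = n * n.+1 %/ 2 + n.+1.
Proof. by rewrite -divnDMl //; congr (_ %/ 2); lia. Qed.

(** The largest element is at most [K + M] or lies exactly [M] above another
    one.  It is never of the form [a - M] for another element [a], so removing
    it preserves the hypothesis, and both bounds follow by induction on the
    size. *)
Lemma sumn_downward_closed (K M : nat) (A : seq nat) :
    0 < M ->
    (forall a, a \in A -> K + M < a -> a - M \in A) ->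
  (forall a, a \in A -> a <= K + size A * M) /\
  sumn A <= size A * K + (size A * (size A).+1 %/ 2) * M.
Proof.
move=> M_gt0; move: {2}(size A) (erefl (size A)) => n.
elim: n A => [|n IH] A szA clA; first by rewrite (size0nil szA).
have [|m mA mP] := @seq_max_exists A; first by rewrite szA.
have pA := perm_to_rem mA; have szr : size (rem m A) = n.
  by move: (perm_size pA); rewrite szA => -[].
have [a aR aM |leR sumR] := IH _ szr.
  have aA := mem_rem aR; have := clA a aA aM.
  rewrite (perm_mem pA) inE => /orP[/eqP eq_m | //].
  by have := mP a aA; lia.
have m_le : m <= K + n.+1 * M.
  have [|Km] := leqP m (K + M); first by lia.
  have := clA m mA Km; rewrite (perm_mem pA) inE => /orP[/eqP|/leR]; first by lia.
  by rewrite szr; lia.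
rewrite szA; split=> [a /mP | ]; first by lia.
rewrite (perm_sumn pA) /= half_pronicS; move: sumR; rewrite szr; lia.
Qed.

Lemma sumn_le_mul (A : seq nat) (K : nat) :
  (forall a, a \in A -> a <= K) -> sumn A <= size A * K.
Proof.
elim: A => //= x A IH leA; have := leA x (mem_head _ _).
by have := IH (fun a aA => leA a (mem_behead (s := x :: A) aA)); lia.
Qed.

(** * Shifting a representation by the period *)

(** The strict bound keeps [z] from representing itself when [t = 1]. *)
Definition entries_below (C : nat -> bool) (z : nat) : seq nat :=
  [seq x <- iota 1 z.-1 | C x].

Lemma mem_entries_below (C : nat -> bool) (z x : nat) :
  (x \in entries_below C z) = [&& C x, 0 < x & x < z].
Proof. by rewrite mem_filter mem_iota; case: z => [|z] //=; lia. Qed.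

(** A summand of a sum with at least two positive terms is less than the sum,
    so moving a summand only requires that the others remain entries. *)
Lemma sum_of_distinct_below (C : nat -> bool) (t y z : nat) :
    1 < t -> sum_of_distinct t (entries_below C y) z ->
  sum_of_distinct t (entries_below C z) z.
Proof.
move=> t_gt1 [A [uA sA AB sumA]]; exists A; split=> // x xA.
have /[!mem_entries_below] /and3P[-> -> _] /= := AB _ xA.
have pA := perm_to_rem xA; move: (perm_size pA) (perm_sumn pA).
case rA: (rem x A) => [|b A'] /=; first by lia.
have bA : b \in A by apply: (@mem_rem _ x); rewrite rA mem_head.
by have /[!mem_entries_below] /and3P[_ ? _] := AB _ bA; lia.
Qed.

Lemma sum_shift_up (C : nat -> bool) (t K M z : nat) :
    1 < t -> 0 < M -> t * K < z ->
    (forall x, K < x -> x < z -> C (x + M) = C x) ->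
  sum_of_distinct t (entries_below C z) z ->
  sum_of_distinct t (entries_below C (z + M)) (z + M).
Proof.
move=> t_gt1 M_gt0 zK perC [A [uA sA AB sumA]].
have [|m mA mP] := @seq_max_exists A; first by rewrite sA; lia.
have /[!mem_entries_below] /and3P[Cm m_gt0 mz] := AB _ mA.
have Km : K < m.
  rewrite ltnNge; apply/negP => mK; have := @sumn_le_mul A K.
  by rewrite sA sumA => /(_ (fun a aA => leq_trans (mP a aA) mK)); lia.
have -> : z + M = sumn A + (m + M) - m by lia.
apply: sum_of_distinct_replace => //.
- by apply/negP => /mP; lia.
- by move=> x /AB; rewrite !mem_entries_below => /and3P[-> ? ?]; lia.
- by rewrite mem_entries_below perC // Cm; lia.
Qed.

Lemma sum_shift_down (C : nat -> bool) (t K M z : nat) :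
    1 < t -> 0 < M -> t * K + (t * t.+1 %/ 2) * M < z + M ->
    (forall x, K < x -> x < z -> C (x + M) = C x) ->
  sum_of_distinct t (entries_below C (z + M)) (z + M) ->
  sum_of_distinct t (entries_below C z) z.
Proof.
move=> t_gt1 M_gt0 zK perC [A [uA sA AB sumA]].
have [/hasP[a aA /andP[KMa aMA]]|/hasPn clA] :=
    boolP (has (fun a => (K + M < a) && (a - M \notin A)) A); last first.
  have [|_] := @sumn_downward_closed K M A M_gt0; last by rewrite sA sumA; lia.
  by move=> a /clA; rewrite negb_and negbK => /orP[/negP|].
have /[!mem_entries_below] /and3P[Ca a_gt0 az] := AB _ aA.
(* The untouched summands are only known to lie below [z + M]. *)
apply: (@sum_of_distinct_below _ _ (z + M)) => //.
have -> : z = sumn A + (a - M) - a by lia.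
have -> : sumn A + (a - M) - a + M = z + M by lia.
apply: sum_of_distinct_replace => //.
rewrite mem_entries_below -perC; [|lia|lia].
by rewrite subnK; lia.
Qed.

(** * The greedy rule as a membership criterion *)

Lemma entries_increasing (t : nat) (s : nat -> nat) :
  tsumfree t s -> forall i j, 0 < i -> i < j -> s i < s j.
Proof.
move=> [_ s_init s_greedy] i j i_gt0; elim: j => // j IH.
have sj k : 0 < k -> s k < s k.+1.
  by move=> k_gt0; have [/s_greedy [[]] | kt] := leqP t k; last by apply: s_init; lia.
rewrite ltnS leq_eqVlt => /orP[/eqP <- | ij]; first exact: sj.
by apply: ltn_trans (IH ij) (sj _ _); lia.
Qed.

Lemma entries_nondecreasing (t : nat) (s : nat -> nat) :
  tsumfree t s -> forall i j, 0 < i -> i <= j -> s i <= s j.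
Proof.
move=> hS i j i_gt0; rewrite leq_eqVlt => /orP[/eqP -> // | ij].
exact: ltnW (entries_increasing hS i_gt0 ij).
Qed.

Lemma entry_ge_index (t : nat) (s : nat -> nat) :
  tsumfree t s -> forall n, 0 < n -> n <= s n.
Proof.
move=> hS; elim=> // n IH _; case: (posnP n) => [-> | n_gt0]; first by case: hS.
exact: leq_ltn_trans (IH n_gt0) (entries_increasing hS n_gt0 (ltnSn n)).
Qed.

Lemma entry_lt_index (t : nat) (s : nat -> nat) :
  tsumfree t s -> forall i j, 0 < j -> s i < s j -> i < j.
Proof.
move=> hS i j j_gt0; apply: contraTT; rewrite -!leqNgt.
exact: entries_nondecreasing hS _ _ j_gt0.
Qed.

Lemma mem_entries (s : nat -> nat) (n x : nat) :
  reflect (exists2 i, 0 < i <= n & s i = x) (x \in entries s n).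
Proof.
apply: (iffP mapP) => [[i] | [i i_in <-]].
  by rewrite mem_iota => i_in ->; exists i => //; lia.
by exists i => //; rewrite mem_iota; lia.
Qed.

Lemma eq_mem_sum_of_distinct (t : nat) (B B' : seq nat) (x : nat) :
  B =i B' -> sum_of_distinct t B x -> sum_of_distinct t B' x.
Proof.
by move=> eqB [A [? ? AB ?]]; exists A; split=> // y /AB; rewrite eqB.
Qed.

Lemma entries_eq_below (t : nat) (s : nat -> nat) (C : nat -> bool) (n z : nat) :
    tsumfree t s -> characteristic_sequence s C ->
    0 < n -> s n < z <= s n.+1 ->
  entries s n =i entries_below C z.
Proof.
move=> hS hC n_gt0 /andP[snz zsn] x; rewrite mem_entries_below.
apply/mem_entries/and3P => [[i /andP[i_gt0 i_n] <-] | [Cx x_gt0 xz]].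
  have si_gt0 : 0 < s i by apply: leq_trans (entry_ge_index hS i_gt0).
  split=> //; first by apply/hC => //; exists i.
  exact: leq_ltn_trans (entries_nondecreasing hS i_gt0 i_n) snz.
have [i i_gt0 six] := (hC x x_gt0).1 Cx; exists i => //.
by rewrite i_gt0 -ltnS; apply: (entry_lt_index hS) => //; lia.
Qed.

(** With [n] the largest index such that [s n < z], the entries below [z] are
    the first [n], and the greedy choice of [s n.+1] says that no [z] strictly
    between [s n] and [s n.+1] is free of representations. *)
Lemma tsumfree_membership (t : nat) (s : nat -> nat) (C : nat -> bool) (z : nat) :
    0 < t -> tsumfree t s -> characteristic_sequence s C -> s t < z ->
  C z <-> ~ sum_of_distinct t (entries_below C z) z.
Proof.
move=> t_gt0 hS hC stz; have [_ _ s_greedy] := hS.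
have ex_n : exists n, (t <= n) && (s n < z) by exists t; rewrite leqnn.
have bound_n n : (t <= n) && (s n < z) -> n <= z.
  by move=> /andP[tn snz]; have := @entry_ge_index _ _ hS n; lia.
case: (ex_maxnP ex_n bound_n) => n /andP[tn snz] n_max.
have zsn : z <= s n.+1.
  by rewrite leqNgt; apply/negP => snz'; have := n_max n.+1; rewrite snz'; lia.
have n_gt0 : 0 < n by lia.
have eqB := @entries_eq_below t s C n z hS hC n_gt0 (introT andP (conj snz zsn)).
have [[_ not_sum] least] := s_greedy n tn.
split=> [Cz sum_z | not_z].
  have [i i_gt0 siz] := (hC z (leq_ltn_trans (leq0n _) snz)).1 Cz.
  have n_i : n < i by apply: (entry_lt_index hS) => //; lia.
  have z_eq : z = s n.+1.
    by have := @entries_nondecreasing _ _ hS n.+1 i; lia.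
  by apply: not_sum; rewrite -z_eq; apply: eq_mem_sum_of_distinct sum_z => x; rewrite eqB.
have -> : z = s n.+1.
  apply/eqP; rewrite eqn_leq zsn /=; apply: least; split=> // sum_z.
  by apply: not_z; apply: eq_mem_sum_of_distinct sum_z.
by apply/hC; [lia | exists n.+1].
Qed.

(** * Periodicity of the characteristic sequence *)

Lemma blocks_agree (C : nat -> bool) (K M Q x : nat) :
    0 < M -> identical_nonnull_blocks C K M Q ->
    K < x -> x + M <= K + Q * M ->
  C (x + M) = C x.
Proof.
move=> M_gt0 [same _] Kx xQ.
have x_eq := divn_eq (x - K.+1) M; have r_lt := ltn_pmod (x - K.+1) M_gt0.
set j := _ %/ M in x_eq; set r := _ %% M in x_eq r_lt.
have jQ : j.+1 < Q.
  by rewrite -(ltn_pmul2r M_gt0); lia.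
have /(congr1 (fun B => nth false B r)) := same j.+1 j jQ (ltnW jQ).
rewrite /block !(nth_map 0) ?size_iota // !nth_iota //.
have -> : K + j.+1 * M + (1 + r) = x + M by lia.
by have -> : K + j * M + (1 + r) = x by lia.
Qed.

(** Each non-null block contributes an entry beyond all earlier blocks. *)
Lemma entry_le_block_end (t : nat) (s : nat -> nat) (C : nat -> bool)
    (K M Q : nat) :
    tsumfree t s -> characteristic_sequence s C ->
    identical_nonnull_blocks C K M Q ->
  forall j, 0 < j <= Q -> s j <= K + j * M.
Proof.
move=> hS hC [_ nonnull]; elim=> // j IH /= jQ.
have /mapP[i] := nonnull j jQ; rewrite mem_iota => i_in Cx.
have [|n n_gt0 sn] := (hC (K + j * M + i) _).1 (esym Cx); first by lia.
suff : j.+1 <= n by move/(entries_nondecreasing hS) => /(_ isT); lia.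
case: (posnP j) => [-> // | j_gt0].
by apply: (entry_lt_index hS) => //; have := IH; lia.
Qed.

Lemma characteristic_periodic (t : nat) (s : nat -> nat) (C : nat -> bool)
    (K M Q : nat) :
    1 < t -> 0 < M -> tsumfree t s -> characteristic_sequence s C ->
    identical_nonnull_blocks C K M Q ->
    t * K + (t * t.+1 %/ 2) * M <= K + Q * M ->
  forall z, K < z -> C (z + M) = C z.
Proof.
move=> t_gt1 M_gt0 hS hC hB hQ.
elim/ltn_ind => z IH Kz; have [zQ | Qz] := leqP (z + M) (K + Q * M).
  exact: blocks_agree hB Kz zQ.
(* Since [t >= 2], one has [t + 1 <= t (t + 1) / 2 <= Q]. *)
have t_half : t.+1 <= t * t.+1 %/ 2 by rewrite leq_divRL //; nia.
have tK : t * K + t.+1 * M <= t * K + (t * t.+1 %/ 2) * M.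
  by rewrite leq_add2l leq_mul2r t_half orbT.
have tQ : t < Q by rewrite -(leq_pmul2r M_gt0); nia.
have stz : s t < z.
  have := @entry_le_block_end _ _ _ _ _ _ hS hC hB t.
  have : t.+1 * M <= Q * M by rewrite leq_mul2r tQ orbT.
  lia.
have perC x : K < x -> x < z -> C (x + M) = C x by move=> Kx xz; apply: IH.
have [up down] := (@sum_shift_up C t K M z, @sum_shift_down C t K M z).
have t_gt0 := ltnW t_gt1.
have memz := tsumfree_membership t_gt0 hS hC stz.
have memzM := tsumfree_membership t_gt0 hS hC (ltn_addr M stz).
apply/idP/idP => [/memzM nz | /memz nz].
  by apply/memz => /up up_z; apply: nz; apply: up_z => //; lia.
by apply/memzM => /down down_z; apply: nz; apply: down_z => //; lia.
Qed.

Lemma ultimately_periodic_block (C : nat -> bool) (K M : nat) :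
    0 < M -> (forall z, K < z -> C (z + M) = C z) ->
  ultimately_periodic C (block C K M 0).
Proof.
move=> M_gt0 perC; rewrite /ultimately_periodic size_map size_iota; split=> //.
exists K => i; have r_lt := ltn_pmod i M_gt0.
rewrite (nth_map 0) ?size_iota // nth_iota // {1}(divn_eq i M).
elim: (i %/ M) => [|q IH]; first by congr C; lia.
rewrite -IH -[RHS]perC; last by lia.
by congr C; lia.
Qed.

(** * Periodicity of the sequence modulo the period *)

Lemma count_entries (t : nat) (s : nat -> nat) (C : nat -> bool) (n : nat) :
    tsumfree t s -> characteristic_sequence s C -> 0 < n ->
  count C (iota 1 (s n)) = n.
Proof.
move=> hS hC n_gt0; rewrite -size_filter -[RHS](size_iota 1) -[RHS](size_map s).
apply/perm_size/uniq_perm.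
- by rewrite filter_uniq // iota_uniq.
- rewrite map_inj_in_uniq ?iota_uniq // => i j; rewrite !mem_iota => i_in j_in sij.
  have [ij|ji|//] := ltngtP i j.
    by have := @entries_increasing _ _ hS i j; lia.
  by have := @entries_increasing _ _ hS j i; lia.
- move=> x; rewrite (@entries_eq_below t s C n (s n).+1 hS hC n_gt0).
    by rewrite [RHS]mem_entries_below mem_filter mem_iota; lia.
  by rewrite ltnSn (entries_increasing hS).
Qed.

Lemma count_window (C : nat -> bool) (K M x : nat) :
    (forall z, K < z -> C (z + M) = C z) -> K <= x ->
  count C (iota x.+1 M) = count C (iota K.+1 M).
Proof.
move=> perC /subnK <-; elim: (x - K) => // d <-.
have : count C (iota (d + K).+1 M.+1) = count C (iota (d + K).+1 M) + C ((d + K).+1 + M).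
  by rewrite -[M.+1]addn1 iotaD count_cat /= addn0.
rewrite [d.+1 + K]addSn /= perC; last by lia.
by rewrite addnC => /addIn.
Qed.

Lemma count_first_block (C : nat -> bool) (K M : nat) :
  count_mem true (block C K M 0) = count C (iota K.+1 M).
Proof.
rewrite -[K.+1]addn1 iotaDl !count_map; apply: eq_count => x /=.
by rewrite mul0n addn0 eqb_id.
Qed.

(** If [n] exceeds the number of entries up to [K], then [s n > K]; counting
    entries up to [s n + M], itself an entry, identifies its index. *)
Lemma tsumfree_periodic_mod (t : nat) (s : nat -> nat) (C : nat -> bool)
    (K M : nat) :
    tsumfree t s -> characteristic_sequence s C ->
    (forall z, K < z -> C (z + M) = C z) ->
  ultimately_periodic_mod s M (count_mem true (block C K M 0))
    (count C (iota 1 K)).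
Proof.
move=> hS hC perC n kn; have n_gt0 : 0 < n by lia.
have sn_gt0 : 0 < s n by apply: leq_trans (entry_ge_index hS n_gt0).
have Ksn : K < s n.
  rewrite ltnNge; apply: contraL kn => snK; rewrite -leqNgt.
  rewrite -{1}(count_entries hS hC n_gt0) -(subnKC snK) iotaD count_cat.
  exact: leq_addr.
have CsnM : C (s n + M) by rewrite perC //; apply/hC => //; exists n.
have [|i i_gt0 si] := (hC (s n + M) _).1 CsnM; first by lia.
have -> // : n + count_mem true (block C K M 0) = i.
rewrite -(count_entries hS hC i_gt0) si iotaD count_cat (count_entries hS hC n_gt0).
by rewrite add1n (count_window perC (ltnW Ksn)) count_first_block.
Qed.

(** * The case of a single summand *)

(** The entries up to [s n] represent only themselves, so [s n + 1] is free. *)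
Lemma one_sumfree_succ (s : nat -> nat) :
  tsumfree 1 s -> forall n, 0 < n -> s n.+1 = (s n).+1.
Proof.
move=> hS n n_gt0; have [_ _ /(_ n n_gt0) [[lt_s _] least]] := hS.
apply/eqP; rewrite eqn_leq lt_s andbT; apply: least; split=> //.
move=> [A [_ sA]]; case: A sA => [|a []] //= _ AB sumA.
have /mem_entries[i i_in sia] := AB a (mem_head _ _).
by have := @entries_nondecreasing _ _ hS i n; lia.
Qed.

Lemma one_sumfree_ultimately_periodic (s : nat -> nat) (C : nat -> bool) :
  tsumfree 1 s -> characteristic_sequence s C -> ultimately_periodic C [:: true].
Proof.
move=> hS hC; split=> //; exists (s 1) => i; rewrite modn1 /=.
apply/hC; first by lia.
exists i.+2 => //; elim: i => [|i IH]; first by rewrite one_sumfree_succ // addn1.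
by rewrite one_sumfree_succ // IH; lia.
Qed.

(** * The theorem *)

Theorem lemma6 (t : nat) (s : nat -> nat) (C : nat -> bool) (K M Q : nat)
  (ht : 1 <= t)
  (hS : tsumfree t s)
  (hC : characteristic_sequence s C)
  (hM : 1 <= M)
  (hQ : 1 <= Q)
  (hblocks : identical_nonnull_blocks C K M Q)
  (hineq : ((Q%:Z - (t * t.+1 %/ 2)%:Z) * M%:Z >= (t%:Z - 1) * K%:Z)%R) :
  exists (m : nat) (E : seq bool),
    [/\ m %| M,
        size E = m,
        ultimately_periodic C E
      & exists2 k : nat,
          k <= count C (iota 1 K)
        & ultimately_periodic_mod s m (count_mem true E) k].
Proof.
have [t_gt1 | t_le1] := ltnP 1 t; last first.
  have t1 : t = 1 by lia.
  rewrite t1 in hS; exists 1, [:: true]; split=> //.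
    exact: one_sumfree_ultimately_periodic hS hC.
  by exists 0 => // n n_gt0; rewrite !addn1 one_sumfree_succ.
have le_Q : t * K + (t * t.+1 %/ 2) * M <= K + Q * M.
  by move: (t * t.+1 %/ 2) hineq => h; nia.
have perC := characteristic_periodic t_gt1 hM hS hC hblocks le_Q.
exists M, (block C K M 0); split=> //.
- by rewrite size_map size_iota.
- exact: ultimately_periodic_block.
- by exists (count C (iota 1 K)) => //; apply: tsumfree_periodic_mod hS hC perC.
Qed.
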